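(* Let $n\ge 1$ and let $A,B,Z$ be $n\times n$ complex matrices such that the product $AB$ is positive semidefinite and $Z$ is positive definite with largest eigenvalue $a$ and smallest eigenvalue $b$. Then for every unitarily invariant norm $\Vert\cdot\Vert$ on $n\times n$ complex matrices, $$\Vert ZAB\Vert \le \frac{a+b}{2\sqrt{ab}}\,\Vert BZA\Vert,$$ and this inequality is sharp (the constant $\frac{a+b}{2\sqrt{ab}}$ cannot be replaced by a smaller one in general).
   Context: A norm $\Vert\cdot\Vert$ on $n\times n$ complex matrices is unitarily invariant (symmetric) if $\Vert UXV\Vert=\Vert X\Vert$ for all matrices $X$ and all unitary $U,V$. ''$AB$ positive semidefinite'' means $AB$ is Hermitian with nonnegative eigenvalues. *)

(* Defs.v *)
(* Complex numbers are R[i] (mathcomp-real-closed) over an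
   arbitrary R : realType (complete archimedean real field), i.e. genuine C. *)
From mathcomp Require Import all_boot all_order all_algebra all_reals.
From mathcomp.real_closed Require Export complex.
Set Implicit Arguments. Unset Strict Implicit. Unset Printing Implicit Defensive.
Import Order.TTheory GRing.Theory Num.Theory.
Local Open Scope ring_scope.

Section MatrixDefs.
Variable C : numClosedFieldType.
Variable n : nat.

Definition adjmx (A : 'M[C]_n) : 'M[C]_n := map_mx Num.conj (A^T).

Definition unitarymx (U : 'M[C]_n) : Prop := U *m adjmx U = 1%:M.

Definition hermitianmx (A : 'M[C]_n) : Prop := adjmx A = A.

Definition psdmx (A : 'M[C]_n) : Prop :=
  hermitianmx A /\ forall l, eigenvalue A l -> 0 <= l.

Definition pdmx (A : 'M[C]_n) : Prop :=
  hermitianmx A /\ forall l, eigenvalue A l -> 0 < l.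

Definition largest_eigenvalue (A : 'M[C]_n) (a : C) : Prop :=
  eigenvalue A a /\ forall l, eigenvalue A l -> l <= a.

Definition smallest_eigenvalue (A : 'M[C]_n) (b : C) : Prop :=
  eigenvalue A b /\ forall l, eigenvalue A l -> b <= l.

(* a norm on n x n complex matrices; values are nonnegative reals (in C) *)
Definition is_mxnorm (N : 'M[C]_n -> C) : Prop :=
  [/\ forall X, 0 <= N X,
      forall X, N X = 0 -> X = 0,
      forall (c : C) X, N (c *: X) = `|c| * N X
    & forall X Y, N (X + Y) <= N X + N Y].

Definition unitarily_invariant (N : 'M[C]_n -> C) : Prop :=
  is_mxnorm N /\
  forall U V X, unitarymx U -> unitarymx V -> N (U *m X *m V) = N X.

End MatrixDefs.

Definition kconst (C : numClosedFieldType) (a b : C) : C :=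
  (a + b) / (2%:R * sqrtC (a * b)).

(* Main.v *)
(* Put P = AB and K = (a+b)/(2 sqrt(ab)). The matrices BZA and ZP have the same
   characteristic polynomial, and so has the positive semidefinite S = W P W, where
   W = Z^(1/2); let lam_1 >= lam_2 >= ... be its eigenvalues. By Schur triangularization
   and pinching, N(diag lam) <= N(BZA). Since N(ZP) depends only on the singular values
   s_j of ZP = W S W^-1, it suffices to show s_j <= K lam_j. A dimension count gives a
   nonzero row vector h with |h ZP| >= s_j |h| such that g = h W lies in the span of the
   eigenvectors of S for lam_j, lam_(j+1), ... Setting u = g S, one has
   |u|^2 <= lam_j <u,g>. The Kantorovich inequality for u and the Cauchy-Schwarz inequality
   <u,g>^2 <= |u W|^2 |g W^-1|^2 then give |h ZP| = |u W^-1| <= K lam_j |h|.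

   Equality holds for the Frobenius norm, Z = diag(a,b) and A = B = h^T h, where
   h = (sqrt b, sqrt a) is the extremal vector of the Kantorovich inequality. *)
Require Import Defs.
From mathcomp Require Import all_boot all_order all_algebra all_reals.
From mathcomp.real_closed Require Import complex.
From mathcomp Require Import fingroup perm ring.
Import Order.TTheory GRing.Theory Num.Theory.
Set Implicit Arguments. Unset Strict Implicit. Unset Printing Implicit Defensive.
Local Open Scope ring_scope.
Local Open Scope sesquilinear_scope.

(** * Characteristic polynomials of products and conjugates *)

(** The block matrix [M] with rows (X, A) and (B, 1) is made block triangular in two ways: a column
    operation gives det M = det(X - AB), and a row operation gives X^n det M = X^n det(X - BA). The
    monic factor X^n cancels, so neither matrix has to be invertible. *)
Lemma char_poly_mulC (F : idomainType) n (A B : 'M[F]_n) :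
  char_poly (A *m B) = char_poly (B *m A).
Proof.
pose A' := map_mx polyC A; pose B' := map_mx polyC B.
pose M := block_mx ('X%:M) A' B' (1%:M : 'M_n).
have charE (U V : 'M[F]_n) : char_poly (U *m V) =
    \det ('X%:M - map_mx polyC U *m map_mx polyC V).
  by rewrite /char_poly /char_poly_mx map_mxM.
have detAB : \det M = char_poly (A *m B).
  have := congr1 determinant (mulmx_block 'X%:M A' B' 1%:M 1%:M 0 (- B') 1%:M).
  rewrite det_mulmx det_lblock !det1 !mulr1 -/M => ->.
  rewrite !mulmx1 !mulmx0 !mul1mx !add0r subrr mulmxN det_ublock det1 mulr1.
  by rewrite charE.
have detBA : \det M * 'X^n = char_poly (B *m A) * 'X^n.
  have := congr1 determinant (mulmx_block 1%:M 0 (- B') 'X%:M 'X%:M A' B' 1%:M).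
  rewrite det_mulmx det_lblock det1 mul1r det_scalar -/M mulrC => ->.
  rewrite !mul1mx !mul0mx !addr0 mulmx1 !mulNmx mul_mx_scalar mul_scalar_mx.
  rewrite addNr det_ublock det_scalar mulrC charE.
  by rewrite addrC.
by apply: (@mulIf _ ('X^n)); rewrite ?monic_neq0 ?monicXn // -detAB.
Qed.

Lemma char_poly_conj (F : fieldType) n (P A Q : 'M[F]_n) :
  Q *m P = 1%:M -> char_poly (P *m A *m Q) = char_poly A.
Proof. by move=> QP; rewrite -mulmxA char_poly_mulC -mulmxA QP mulmx1. Qed.

Lemma prod_XsubC_perm (F : fieldType) n (d e : 'I_n -> F) :
  \prod_(i < n) ('X - (d i)%:P) = \prod_(i < n) ('X - (e i)%:P) ->
  exists p : 'S_n, forall i, d i = e (p i).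
Proof.
move=> de.
have /tuple_permP[p dep] : perm_eq [tuple d i | i < n] [tuple e i | i < n].
  by apply: prod_XsubC_eq; rewrite !big_map -!big_enum /= in de *.
exists p => i; have := congr1 (fun s => nth (d i) s i) dep.
by rewrite -!tnth_nth !tnth_mktuple.
Qed.

(** * Unitarily invariant norms: monotonicity on diagonals, pinching, eigenvalues *)

Section UnitaryNorm.
Context {C : numClosedFieldType}.

Lemma unitary_permmx n (p : 'S_n) : (perm_mx p : 'M[C]_n) \is unitarymx.
Proof.
by apply/unitarymxP; rewrite tr_perm_mx map_perm_mx -perm_mxM mulgV perm_mx1.
Qed.

Definition signmx {n} (k : 'I_n) : 'M[C]_n :=
  diag_mx (\row_j (if j == k then -1 else 1)).

Lemma unitary_signmx n (k : 'I_n) : signmx k \is unitarymx.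
Proof.
apply/unitarymxP; rewrite tr_diag_mx map_diag_mx mulmx_diag -diag_const_mx.
congr diag_mx; apply/rowP => j; rewrite !mxE.
by case: eqP => _; rewrite ?rmorphN rmorph1 ?mulr1 ?mulrNN ?mulr1.
Qed.

Variables (n : nat) (N : 'M[C]_n -> C).
Hypothesis N_inv : unitarily_invariant N.

Lemma uinorm_mul (U X V : 'M[C]_n) :
  U \is unitarymx -> V \is unitarymx -> N (U *m X *m V) = N X.
Proof. by move=> /unitarymxP U1 /unitarymxP V1; case: N_inv => _; apply. Qed.

Lemma uinorm_mull (U X : 'M[C]_n) : U \is unitarymx -> N (U *m X) = N X.
Proof.
move=> U1; rewrite -[U *m X]mulmx1 uinorm_mul //.
by apply/unitarymxP; rewrite trmx1 map_mx1 mulmx1.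
Qed.

Lemma uinorm_scale (c : C) X : 0 <= c -> N (c *: X) = c * N X.
Proof. by move=> c0; case: N_inv => -[_ _ -> _] _; rewrite ger0_norm. Qed.

Lemma uinorm_convex (t : C) X Y : 0 <= t <= 1 -> N Y = N X ->
  N (t *: X + (1 - t) *: Y) <= N X.
Proof.
move=> /andP[t0 t1] NYX; case: (N_inv) => -[_ _ _ /(_ (t *: X) ((1 - t) *: Y)) NT] _.
apply: (le_trans NT); rewrite !uinorm_scale ?subr_ge0 // NYX -mulrDl.
by rewrite addrC subrK mul1r.
Qed.

(* Scaling row [k] by [r 0 k] is a convex combination of [X] and [signmx k *m X]. *)
Lemma uinorm_shrink (r : 'rV[C]_n) X : (forall i, 0 <= r 0 i <= 1) ->
  N (diag_mx r *m X) <= N X.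
Proof.
move=> r01; pose rs (s : seq 'I_n) : 'rV[C]_n := \row_i (if i \in s then r 0 i else 1).
suff shr s : uniq s -> N (diag_mx (rs s) *m X) <= N X.
  have <- : rs (enum 'I_n) = r by apply/rowP => i; rewrite mxE mem_enum.
  exact/shr/enum_uniq.
elim: s => [_|k s IHs /= /andP[ks us]].
  suff -> : rs [::] = const_mx 1 by rewrite diag_const_mx mul1mx.
  by apply/rowP => i; rewrite !mxE.
apply: le_trans (IHs us); set Y := diag_mx (rs s) *m X.
(* The weight t = (1 + r)/2 solves t - (1 - t) = r, with r the entry of [r] at [k]. Since [k] is not
   in [s], row [k] has not been scaled before. *)
have -> : diag_mx (rs (k :: s)) *m X =
    ((1 + r 0 k) / 2%:R) *: Y + (1 - (1 + r 0 k) / 2%:R) *: (signmx k *m Y).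
  apply/matrixP => i j; rewrite /Y /signmx !mul_diag_mx !mxE inE.
  case: (eqVneq i k) => [->|_] /=; last by rewrite mul1r -mulrDl addrC subrK mul1r.
  by rewrite (negPf ks) mul1r mulN1r mulrN -mulrBl opprB addrA -splitr addrAC subrr add0r.
have /andP[r0 r1] := r01 k.
apply: uinorm_convex; last by rewrite uinorm_mull ?unitary_signmx.
rewrite divr_ge0 ?addr_ge0 ?ler0n //= ler_pdivrMr ?ltr0n // mul1r.
by rewrite lerD2l.
Qed.

Lemma uinorm_diag_le (s t : 'rV[C]_n) : (forall i, 0 <= s 0 i <= t 0 i) ->
  N (diag_mx s) <= N (diag_mx t).
Proof.
move=> st; pose r : 'rV[C]_n := \row_i (s 0 i / t 0 i).
have -> : diag_mx s = diag_mx r *m diag_mx t.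
  rewrite mulmx_diag; congr diag_mx; apply/rowP => i; rewrite !mxE.
  (* Where [t] vanishes the quotient [r] is 0 by convention, and [s] vanishes there too, being
     squeezed between 0 and [t]. *)
  have /andP[s0 sti] := st i; have [t0|t0] := eqVneq (t 0 i) 0; last by rewrite divfK.
  by apply/eqP; rewrite t0 mulr0 eq_le s0 andbT -t0.
apply: uinorm_shrink => i; rewrite mxE; have /andP[s0 sti] := st i.
have t0 := le_trans s0 sti; rewrite divr_ge0 //=.
have [->|tn0] := eqVneq (t 0 i) 0; first by rewrite invr0 mulr0 ler01.
by rewrite ler_pdivrMr ?mul1r // lt_def tn0.
Qed.

(* Averaging [T] with its conjugate by [signmx k] erases the off-diagonal entries of
   row and column [k]. *)
Lemma uinorm_pinch (T : 'M[C]_n) : N (diag_mx (\row_i T i i)) <= N T.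
Proof.
pose Ts (s : seq 'I_n) : 'M[C]_n :=
  \matrix_(i, j) (if (i != j) && ((i \in s) || (j \in s)) then 0 else T i j).
suff pin s : N (Ts s) <= N T.
  suff <- : Ts (enum 'I_n) = diag_mx (\row_i T i i) by apply: pin.
  apply/matrixP => i j; rewrite !mxE !mem_enum /= andbT.
  by case: eqVneq => [->|_] //=; rewrite ?mulr1n ?mulr0n.
elim: s => [|k s]; first by suff -> : Ts [::] = T by []; apply/matrixP => i j; rewrite !mxE andbF.
apply: le_trans.
have -> : Ts (k :: s) = 2%:R^-1 *: Ts s + (1 - 2%:R^-1) *: (signmx k *m Ts s *m signmx k).
  have half : 1 - 2%:R^-1 = 2%:R^-1 :> C by rewrite {1}[1]splitr mul1r addrK.
  rewrite half -scalerDr; apply/matrixP => i j.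
  rewrite /signmx mul_diag_mx mul_mx_diag !mxE !inE.
  have split2 (x : C) : x = 2%:R^-1 * (x + x).
    by rewrite -mulr2n -[x *+ 2]mulr_natl mulKf ?pnatr_eq0.
  case: (eqVneq i k) => [->|ik]; case: (eqVneq j k) => [->|jk].
  - by rewrite /= mulN1r mulrN1 opprK -split2.
  - by rewrite /= mulN1r mulr1 addrN mulr0.
  - by rewrite ik /= orbT mul1r mulrN1 addrN mulr0.
  - by rewrite /= mul1r mulr1 -split2.
apply: uinorm_convex; last by rewrite uinorm_mul ?unitary_signmx.
by rewrite invr_ge0 ler0n invf_le1 ?ltr0n ?ler1n.
Qed.

Lemma uinorm_permute (d : 'rV[C]_n) (p : 'S_n) :
  N (diag_mx (\row_i d 0 (p i))) = N (diag_mx d).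
Proof.
rewrite -(@uinorm_mul (perm_mx p) (diag_mx d) (perm_mx p^-1)%g) ?unitary_permmx //.
rewrite -row_permE -col_permE; congr N; apply/matrixP => i j; rewrite !mxE.
by rewrite (inj_eq perm_inj).
Qed.

(** [M] need not be normal: it is unitarily similar to a triangular [T] whose diagonal carries the
    eigenvalues, and pinching isolates that diagonal. The order in which [l] lists them is absorbed
    by [uinorm_permute]. *)
Lemma uinorm_char_poly (M : 'M[C]_n) (l : 'rV[C]_n) :
  char_poly M = \prod_(i < n) ('X - (l 0 i)%:P) -> N (diag_mx l) <= N M.
Proof.
have [n0|n_gt0] := posnP n.
  suff -> : diag_mx l = M by [].
  by apply/matrixP => i; have := leq_trans (ltn_ord i) (eq_leq n0).
have [P Pu Ptrig] := Schur M n_gt0.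
move: Ptrig; rewrite /similar_to conjymx // => Ptrig Ml.
pose T := P *m M *m P^t*.
have PtP : P^t* *m P = 1%:M by rewrite -invmx_unitary // mulVmx ?unitarymx_unit.
have -> : N M = N T by rewrite uinorm_mul ?trmxC_unitary.
have [|p lp] := @prod_XsubC_perm _ n (fun i => l 0 i) (fun i => T i i).
  by rewrite -Ml -char_poly_trig // char_poly_conj.
apply: le_trans (uinorm_pinch T); rewrite -[leRHS](uinorm_permute _ p).
suff -> : l = \row_i (\row_j T j j) 0 (p i) by [].
by apply/rowP => i; rewrite lp [RHS]mxE [RHS]mxE.
Qed.

End UnitaryNorm.

(** * Inner products of rows, singular value decomposition, Kantorovich inequality *)

Section SingularValues.
Context {C : numClosedFieldType}.
Local Notation "''[' u , v ]" := (dotmx u v) : ring_scope.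
Local Notation "''[' u ]" := (dotmx u u) : ring_scope.

Lemma dotmx_sum n (u v : 'rV[C]_n) : '[u, v] = \sum_i u 0 i * (v 0 i)^*.
Proof. by rewrite dotmxE mxE; apply: eq_bigr => i _; rewrite !mxE. Qed.

Lemma dotmx_sqr n (u : 'rV[C]_n) : '[u] = \sum_i `|u 0 i| ^+ 2.
Proof. by rewrite dotmx_sum; apply: eq_bigr => i _; rewrite normCK. Qed.

Lemma dotmx_ge0 n (u : 'rV[C]_n) : 0 <= '[u].
Proof. by rewrite dotmx_sqr sumr_ge0 // => i _; rewrite exprn_ge0. Qed.

Lemma dotmx_gt0 n (u : 'rV[C]_n) : u != 0 -> 0 < '[u].
Proof. exact: dotmx_is_dotmx. Qed.

Lemma dotmx_unitary n (U : 'M[C]_n) (u v : 'rV[C]_n) : U \is unitarymx ->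
  '[u *m U, v *m U] = '[u, v].
Proof.
by move=> Uu; rewrite !dotmxE trmx_mul map_mxM mulmxA mulmxtVK.
Qed.

Lemma dotmx_diag n (u v d : 'rV[C]_n) : '[u *m diag_mx d, v] = \sum_i d 0 i * (u 0 i * (v 0 i)^*).
Proof.
rewrite dotmx_sum; apply: eq_bigr => i _.
by rewrite mul_mx_diag mxE mulrAC mulrC.
Qed.

Lemma dotmx_diag_sqr n (u d : 'rV[C]_n) : (forall i, 0 <= d 0 i) ->
  '[u *m diag_mx d] = \sum_i d 0 i ^+ 2 * `|u 0 i| ^+ 2.
Proof.
move=> d0; rewrite dotmx_sqr; apply: eq_bigr => i _.
by rewrite mul_mx_diag mxE normrM exprMn (ger0_norm (d0 i)) mulrC.
Qed.

Lemma sort_row n (d : 'rV[C]_n) : (forall i, 0 <= d 0 i) ->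
  exists p : 'S_n, forall i j : 'I_n, (i <= j)%N -> d 0 (p j) <= d 0 (p i).
Proof.
move=> d0; pose t := [tuple d 0 i | i < n].
pose s := sort_tuple >=%R t.
have /tuple_permP[p sp] : perm_eq s t by apply: permEl (perm_sort _ _).
exists p => i j ij; have sE (k : 'I_n) : tnth s k = d 0 (p k).
  by rewrite (tnth_nth 0) sp -tnth_nth tnth_mktuple tnth_mktuple.
rewrite -!sE !(tnth_nth 0).
(* The order on [C] is partial; it is total on the nonnegative entries, which is enough for
   sorting. *)
have srt : sorted >=%R s.
  apply: (@sort_sorted_in _ [pred x : C | 0 <= x]).
    by move=> x y x0 y0; apply: real_leVge; apply: ger0_real.
  by apply/allP => x /mapP[k _ ->]; apply: d0.
have tr : transitive (>=%R : rel C) by move=> x y z yx xz; exact: le_trans xz yx.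
apply: (sorted_leq_nth tr _ _ srt) => //; first by move=> x; apply: lexx.
  by rewrite inE size_tuple.
by rewrite inE size_tuple.
Qed.

(** Nonzero orthogonal rows only need normalising, with [s] recording their lengths. Zero rows are
    removed one at a time, by induction on their number. *)
Lemma orthogonal_rows_polar n (Y : 'M[C]_n) :
  (forall i j, i != j -> '[row i Y, row j Y] = 0) ->
  exists U : 'M[C]_n, exists s : 'rV[C]_n,
    [/\ U \is unitarymx, forall i, 0 <= s 0 i & Y = diag_mx s *m U].
Proof.
have [k] := ubnP #|[pred i | row i Y == 0]|; elim: k Y => // k IHk Y.
rewrite ltnS => Yk Yorth.
have [i0 /eqP Yi0|Ynz] := pickP [pred i | row i Y == 0]; last first.
  have Ypos i : 0 < sqrtC '[row i Y].
    by rewrite sqrtC_gt0 dotmx_gt0 //; apply/negbT/Ynz.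
  pose s := \row_i sqrtC '[row i Y].
  pose U := diag_mx (\row_i (s 0 i)^-1) *m Y.
  have rowU i : row i U = (sqrtC '[row i Y])^-1 *: row i Y.
    by apply/rowP => j; rewrite /U mul_diag_mx !mxE.
  exists U, s; split.
  - apply/row_unitarymxP => i j; rewrite !rowU linearZl_LR linearZr_LR /=.
    have [->|ij] := eqVneq i j; last by rewrite (Yorth i j) // !mulr0.
    rewrite geC0_conj ?invr_ge0 ?(ltW (Ypos j)) // mulrA -expr2 exprVn sqrtCK.
    by rewrite mulVf // -[X in X != 0]sqrtCK sqrf_eq0 gt_eqF.
  - by move=> i; rewrite mxE ltW.
  rewrite /U mulmxA mulmx_diag; suff -> : \row_i (s 0 i * (\row_i (s 0 i)^-1) 0 i) = const_mx 1.
    by rewrite diag_const_mx mul1mx.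
  by apply/rowP => i; rewrite !mxE mulfV ?gt_eqF.
(* A zero row is replaced by a nonzero vector [v] orthogonal to all the rows. *)
have /det0P[v v0 vY] : \det (Y^t*) == 0.
  rewrite det_map_mx det_tr conjC_eq0; apply/det0P; exists (delta_mx 0 i0).
    by apply/eqP => /rowP/(_ i0)/eqP; rewrite !mxE !eqxx oner_eq0.
  by rewrite -rowE.
have vYrow i : '[v, row i Y] = 0.
  have /rowP/(_ i) := vY; rewrite [RHS]mxE => <-.
  by rewrite dotmx_sum mxE; apply: eq_bigr => j _; rewrite !mxE.
pose Y' := \matrix_(i, j) (if i == i0 then v 0 j else Y i j).
have rowY' i : row i Y' = if i == i0 then v else row i Y.
  by apply/rowP => j; rewrite !mxE; case: ifP => // _; rewrite mxE.
have [] := IHk Y'.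
- rewrite (leq_trans _ Yk) //; apply: proper_card; apply/properP; split.
    by apply/subsetP => i; rewrite !inE rowY'; case: ifP; rewrite ?(negPf v0).
  by exists i0; rewrite !inE ?Yi0 // rowY' eqxx.
- move=> i j ij; rewrite !rowY'; case: eqVneq => [ii|_]; case: eqVneq => [jj|_].
  + by rewrite ii jj eqxx in ij.
  + exact: vYrow.
  + by rewrite hermC /= expr0 mul1r vYrow rmorph0.
  + exact: Yorth.
move=> U [s [Uu s0 Y'E]].
(* A zero scale at [i0] restores the zero row of [Y] and keeps [U] unitary. *)
exists U, (\row_i if i == i0 then 0 else s 0 i); split=> //.
  by move=> i; rewrite mxE; case: ifP.
apply/row_matrixP => i; apply/rowP => j; rewrite mul_diag_mx !mxE.
case: eqVneq => [->|ii]; first by have /rowP/(_ j) := Yi0; rewrite !mxE mul0r.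
by have /matrixP/(_ i j) := Y'E; rewrite mul_diag_mx !mxE (negPf ii).
Qed.

Lemma hermitian_spectral n (H : 'M[C]_n) : H^t* = H ->
  exists P : 'M[C]_n, exists d : 'rV[C]_n,
    P \is unitarymx /\ H = P^t* *m diag_mx d *m P.
Proof.
move=> HH; have /orthomx_spectral_subproof[[P d] /= Pu ->] : H \is normalmx.
  by apply/normalmxP; rewrite HH.
by exists P, d; rewrite invmx_unitary.
Qed.

(** If [P] diagonalises [X *m X^t*], the Gram matrix of the rows of [P *m X] is diagonal, so
    [orthogonal_rows_polar] applies to [P *m X]. A permutation then puts the scales in decreasing
    order. *)
Lemma singular_value_decomposition n (X : 'M[C]_n) :
  exists U V : 'M[C]_n, exists s : 'rV[C]_n,
   [/\ U \is unitarymx, V \is unitarymx, forall i, 0 <= s 0 i,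
       forall i j : 'I_n, (i <= j)%N -> s 0 j <= s 0 i
     & X = U *m diag_mx s *m V].
Proof.
have [|P [d [Pu XP]]] := @hermitian_spectral _ (X *m X^t*).
  by rewrite trmx_mul map_mxM /= trmxCK.
have [|V [s [Vu s0 PX]]] := @orthogonal_rows_polar _ (P *m X).
  move=> i j ij.
  have : (P *m X) *m (P *m X)^t* = diag_mx d.
    rewrite trmx_mul map_mxM mulmxA -(mulmxA P) XP !mulmxA mulmxtVK //.
    by rewrite (unitarymxP Pu) mul1mx.
  move=> /matrixP/(_ i j); rewrite [RHS]mxE (negPf ij) mulr0n => <-.
  by rewrite dotmx_sum !mxE; apply: eq_bigr => k _; rewrite !mxE.
have [p sp] := sort_row s0.
exists (P^t* *m perm_mx p^-1), (perm_mx p *m V), (\row_i s 0 (p i)); split.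
- by rewrite mul_unitarymx ?trmxC_unitary ?unitary_permmx.
- by rewrite mul_unitarymx ?unitary_permmx.
- by move=> i; rewrite mxE.
- by move=> i j ij; rewrite !mxE sp.
have -> : diag_mx (\row_i s 0 (p i)) = perm_mx p *m diag_mx s *m perm_mx p^-1.
  rewrite -row_permE -col_permE; apply/matrixP => i j; rewrite !mxE.
  by rewrite (inj_eq perm_inj).
have pp : perm_mx p^-1 *m perm_mx p = 1%:M :> 'M[C]_n.
  by rewrite -perm_mxM mulVg perm_mx1.
rewrite !mulmxA -[X in X *m diag_mx s]mulmxA pp mulmx1.
rewrite -[X in X *m V]mulmxA pp mulmx1 -mulmxA -PX mulmxA.
by rewrite -invmx_unitary // mulVmx ?mul1mx ?unitarymx_unit.
Qed.

(** Summing (a - z)(z - b)/z >= 0 against the weights [w] gives p + ab q <= (a + b) m; the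
    arithmetic-geometric mean inequality for p and ab q concludes. *)
Lemma kantorovich n (z w : 'I_n -> C) (a b : C) : 0 < a -> 0 < b ->
  (forall i, b <= z i <= a) -> (forall i, 0 <= w i) ->
  a * b * ((\sum_i z i * w i) * (\sum_i (z i)^-1 * w i)) *+ 4
    <= (a + b) ^+ 2 * (\sum_i w i) ^+ 2.
Proof.
move=> a0 b0 zab w0.
have z0 i : 0 < z i by apply: lt_le_trans b0 _; case/andP: (zab i).
set p := \sum_i z i * w i; set q := \sum_i (z i)^-1 * w i; set m := \sum_i w i.
have p0 : 0 <= p by apply: sumr_ge0 => i _; rewrite mulr_ge0 // ltW.
have q0 : 0 <= q by apply: sumr_ge0 => i _; rewrite mulr_ge0 // invr_ge0 ltW.
have abq0 : 0 <= a * b * q by rewrite mulr_ge0 // mulr_ge0 ?ltW.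
have m0 : 0 <= m by apply: sumr_ge0.
have pq : p + a * b * q <= (a + b) * m.
  rewrite mulr_sumr mulr_sumr -big_split /=; apply: ler_sum => i _.
  rewrite mulrA -mulrDl ler_wpM2r // -subr_ge0.
  have -> : a + b - (z i + a * b / z i) = (a - z i) * (z i - b) / z i.
    by field; rewrite gt_eqF.
  by have /andP[? ?] := zab i; rewrite divr_ge0 ?mulr_ge0 ?subr_ge0 // ltW.
have abpq : p * (a * b * q) *+ 4 <= (p + a * b * q) ^+ 2.
  by rewrite real_leif_AGM2_scaled ?ger0_real.
have -> : a * b * (p * q) = p * (a * b * q) by rewrite mulrCA.
apply: (le_trans abpq); rewrite -exprMn ler_pXn2r ?nnegrE //.
  by rewrite addr_ge0.
by rewrite mulr_ge0 // addr_ge0 ?ltW.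
Qed.

End SingularValues.

(** * The norm inequality *)

Section Inequality.
Context {C : numClosedFieldType}.
Local Notation "''[' u , v ]" := (dotmx u v) : ring_scope.
Local Notation "''[' u ]" := (dotmx u u) : ring_scope.

Lemma kconst_ge0 (a b : C) : 0 < a -> 0 < b -> 0 <= kconst a b.
Proof.
move=> a0 b0; rewrite /kconst divr_ge0 ?addr_ge0 ?mulr_ge0 ?ler0n ?sqrtC_ge0 ?ltW //.
exact: mulr_gt0.
Qed.

(** The scalar end of the argument, for p = |uW|^2, q = |uW^-1|^2, r = |gW^-1|^2, m = |u|^2, t =
    <u,g>, l = lam_j and s = s_j. The hypotheses chain to 4ab p s^2 r <= 4ab pq <= (a+b)^2 m^2 <=
    (a+b)^2 l^2 t^2 <= (a+b)^2 l^2 pr, and the factor pr cancels. *)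
Lemma le_kconst (a b p q r m t l s : C) : 0 < a -> 0 < b ->
  0 < p -> 0 <= m -> 0 < r -> 0 <= l -> 0 <= s -> 0 <= t ->
  m <= l * t -> t ^+ 2 <= p * r ->
  a * b * (p * q) *+ 4 <= (a + b) ^+ 2 * m ^+ 2 -> s ^+ 2 * r <= q ->
  s <= kconst a b * l.
Proof.
move=> a0 b0 p0 m0 r0 l0 s0 t0 mlt tpr pqm srq.
have g0 : 0 < sqrtC (a * b) by rewrite sqrtC_gt0 mulr_gt0.
have ab0 : 0 <= a + b by rewrite addr_ge0 ?ltW.
rewrite /kconst mulrAC ler_pdivlMr ?mulr_gt0 ?ltr0n //.
rewrite -(@ler_pXn2r _ 2) ?nnegrE ?mulr_ge0 ?ler0n ?(ltW g0) //.
rewrite -(ler_pM2r (mulr_gt0 p0 r0)) !exprMn sqrtCK.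
have -> : s ^+ 2 * (2%:R ^+ 2 * (a * b)) * (p * r) = a * b * (p * (s ^+ 2 * r)) *+ 4 by ring.
apply: (@le_trans _ _ (a * b * (p * q) *+ 4)).
  by rewrite ler_pMn2r // ler_pM2l ?mulr_gt0 // ler_pM2l.
apply: (le_trans pqm); rewrite -[leRHS]mulrA ler_wpM2l ?exprn_ge0 //.
apply: (@le_trans _ _ ((l * t) ^+ 2)).
  by rewrite ler_pXn2r ?nnegrE ?mulr_ge0.
by rewrite exprMn ler_wpM2l ?exprn_ge0.
Qed.

(* The [j] conditions on [c *m G] and the [n - 1 - j] conditions on [c] are together
   the columns of a matrix whose [j]-th column is zero, hence which is singular. *)
Lemma exists_common_support n (G : 'M[C]_n) (j : 'I_n) :
  exists2 c : 'rV[C]_n, c != 0 &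
    (forall i : 'I_n, (j < i)%N -> c 0 i = 0) /\
    (forall i : 'I_n, (i < j)%N -> (c *m G) 0 i = 0).
Proof.
pose F := \matrix_(i, k < n) (if (k < j)%N then G i k else ((k != j) && (i == k))%:R).
have /det0P[c c0 cF] : \det F == 0.
  rewrite -det_tr; apply/det0P; exists (delta_mx 0 j).
    by apply/eqP => /rowP/(_ j)/eqP; rewrite !mxE !eqxx oner_eq0.
  by rewrite -rowE; apply/rowP => k; rewrite !mxE ltnn eqxx.
exists c => //; split=> i ij; have /rowP/(_ i) := cF; rewrite !mxE.
  rewrite (bigD1 i) //= big1 => [|k ki].
    by rewrite !mxE ltnNge (ltnW ij) /= eqxx -val_eqE gtn_eqF // mulr1 addr0.
  by rewrite !mxE ltnNge (ltnW ij) /= (negPf ki) andbF mulr0.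
by move=> cFi; rewrite -[RHS]cFi; apply: eq_bigr => k _; rewrite !mxE ij.
Qed.

(** The bound is index by index, so that [uinorm_diag_le] can turn it into a bound for all unitarily
    invariant norms at once. *)
Lemma similar_singular_value_le n (a b : C) (w lam s : 'rV[C]_n) (Q U V : 'M[C]_n) :
  0 < a -> 0 < b ->
  (forall i, 0 < w 0 i) -> (forall i, b <= w 0 i ^+ 2 <= a) ->
  (forall i, 0 <= lam 0 i) -> (forall i, 0 <= s 0 i) ->
  (forall i j : 'I_n, (i <= j)%N -> lam 0 j <= lam 0 i) ->
  (forall i j : 'I_n, (i <= j)%N -> s 0 j <= s 0 i) ->
  Q \is unitarymx -> U \is unitarymx -> V \is unitarymx ->
  diag_mx w *m (Q^t* *m diag_mx lam *m Q) *m diag_mx (\row_i (w 0 i)^-1)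
    = U *m diag_mx s *m V ->
  forall j, s 0 j <= kconst a b * lam 0 j.
Proof.
move=> a0 b0 w0 wab lam0 s0 lam_dec s_dec Qu Uu Vu XE j.
set W := diag_mx w in XE; set W' := diag_mx (\row_i _) in XE.
have w'0 i : 0 < (\row_i (w 0 i)^-1) 0 i by rewrite mxE invr_gt0.
have WW' : W *m W' = 1%:M.
  rewrite mulmx_diag -diag_const_mx; congr diag_mx; apply/rowP => i.
  by rewrite !mxE mulfV ?gt_eqF.
(* The matrix passes from the coordinates [c] of [h] in the left singular basis to the coordinates
   [e] of [h *m W] in the eigenbasis. The subspaces allowed for [c] and [e] have dimensions j + 1
   and n - j, whose sum exceeds n. *)
have [c c0 [c_lo c_hi]] := exists_common_support (U^t* *m W *m Q^t*) j.
set e := c *m _ in c_hi.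
(* [c] lies in the span of the first [j + 1] singular directions, so
   [U *m diag_mx s *m V] stretches [h] by at least [s 0 j], while [e] lies where the
   eigenvalues are at most [lam 0 j]. *)
pose h := c *m U^t*; pose g := h *m W; pose u := e *m diag_mx lam *m Q.
have gE : g = e *m Q.
  by rewrite /e /g /h !mulmxA mulmxKtV.
have uE : u *m W' = c *m diag_mx s *m V.
  rewrite /u /e !mulmxA.
  rewrite -[RHS]mul1mx.
  transitivity (c *m U^t* *m (U *m diag_mx s *m V)); first by rewrite -XE !mulmxA.
  by rewrite !mulmxA mulmxKtV // mul1mx.
have hE : g *m W' = h by rewrite /g -mulmxA WW' mulmx1.
have r0 : 0 < '[g *m W'] by rewrite hE dotmx_unitary ?trmxC_unitary ?dotmx_gt0.
have tE : '[u, g] = \sum_i lam 0 i * `|e 0 i| ^+ 2.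
  rewrite gE dotmx_unitary // dotmx_diag; apply: eq_bigr => i _.
  by rewrite normCK.
have t0 : 0 <= '[u, g].
  by rewrite tE sumr_ge0 // => i _; rewrite mulr_ge0 ?exprn_ge0.
(* The left side is the sum of lam_i^2 |e_i|^2, where only i >= j contributes, and there one factor
   lam_i is at most lam_j. *)
have mlt : '[u] <= lam 0 j * '[u, g].
  rewrite dotmx_unitary // dotmx_diag_sqr // tE mulr_sumr; apply: ler_sum => i _.
  rewrite expr2 -mulrA; have [ij|ij] := ltnP i j.
    by rewrite c_hi // normr0 expr0n !mulr0.
  by rewrite ler_wpM2r ?mulr_ge0 ?exprn_ge0 // lam_dec.
(* [W] and [W'] are inverse real diagonal matrices, so <u,g> = <uW, gW'>, to which Cauchy-Schwarz
   applies. *)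
have tpr : '[u, g] ^+ 2 <= '[u *m W] * '[g *m W'].
  have dotWW' x y : '[x *m W, y *m W'] = '[x, y].
    rewrite !dotmx_sum; apply: eq_bigr => i _.
    rewrite !mul_mx_diag !mxE rmorphM /= [_^-1^*]geC0_conj ?invr_ge0 ?ltW //.
    by rewrite mulrACA mulfV ?mulr1 ?gt_eqF.
  rewrite -[dotmx u g]dotWW' -[dotmx _ _ in leLHS]ger0_norm ?dotWW' //.
  by rewrite -(dotWW' u g) CauchySchwarz.
have pqm : a * b * ('[u *m W] * '[u *m W']) *+ 4 <= (a + b) ^+ 2 * '[u] ^+ 2.
  rewrite (dotmx_diag_sqr _ (fun i => ltW (w0 i))) (dotmx_diag_sqr _ (fun i => ltW (w'0 i))).
  rewrite dotmx_sqr.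
  have := @kantorovich C n (fun i => w 0 i ^+ 2) (fun i => `|u 0 i| ^+ 2) a b a0 b0 wab.
  set q := \sum_i (_ ^+ 2)^-1 * _.
  suff <- : q = \sum_i (\row_k (w 0 k)^-1) 0 i ^+ 2 * `|u 0 i| ^+ 2.
    by apply=> i; rewrite exprn_ge0.
  by apply: eq_bigr => i _; rewrite mxE exprVn.
have srq : s 0 j ^+ 2 * '[g *m W'] <= '[u *m W'].
  rewrite hE uE (dotmx_unitary _ _ Vu) dotmx_diag_sqr // dotmx_unitary ?trmxC_unitary //.
  rewrite dotmx_sqr mulr_sumr.
  apply: ler_sum => i _; have [ij|ij] := ltnP j i.
    by rewrite c_lo // normr0 expr0n !mulr0.
  by rewrite ler_wpM2r ?exprn_ge0 // ler_pXn2r ?nnegrE // s_dec.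
(* [le_kconst] cancels |uW|^2, so u = 0 is treated apart: there [srq] forces s_j = 0. *)
have [u0|u0] := eqVneq u 0; last first.
  apply: (le_kconst a0 b0 _ _ r0 _ _ t0 mlt tpr pqm srq) => //; last exact: dotmx_ge0.
  rewrite dotmx_gt0 //; apply: contraNneq u0 => uW.
  by rewrite -[u]mulmx1 -WW' mulmxA uW mul0mx.
apply: (@le_trans _ _ 0); last by rewrite mulr_ge0 ?kconst_ge0.
rewrite u0 mul0mx linear0l pmulr_lle0 // in srq.
rewrite real_leNgt ?real0 ?ger0_real //; apply/negP => /(exprn_gt0 2) sj.
by rewrite (lt_geF sj) in srq.
Qed.


Lemma eigenvalue_spectral n (U : 'M[C]_n) (d : 'rV[C]_n) i : U \is unitarymx ->
  eigenvalue (U^t* *m diag_mx d *m U) (d 0 i).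
Proof.
move=> Uu; apply/eigenvalueP; exists (row i U).
  rewrite rowE !mulmxA -(mulmxA _ U) (unitarymxP Uu) mulmx1.
  suff -> : (delta_mx 0 i : 'rV_n) *m diag_mx d = d 0 i *: delta_mx 0 i by rewrite scalemxAl.
  apply/rowP => j; rewrite mul_mx_diag !mxE eqxx /= mulrC.
  by case: eqVneq => [->|]; rewrite ?mulr1 ?mulr0.
apply/eqP => U0; have /row_unitarymxP/(_ i i) := Uu.
by rewrite U0 linear0l eqxx => /eqP; rewrite eq_sym oner_eq0.
Qed.

Lemma psdmx_gram n (X : 'M[C]_n) : psdmx (X *m X^t*).
Proof.
split; first by rewrite /Defs.hermitianmx /adjmx trmx_mul map_mxM /= trmxCK.
move=> l /eigenvalueP[v vl v0].
have := dotmx_ge0 (v *m X).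
rewrite dotmxE trmx_mul map_mxM !mulmxA -(mulmxA v) vl -scalemxAl mxE -dotmxE.
by rewrite pmulr_lge0 ?dotmx_gt0.
Qed.

(** The case of diagonal Z. The norm of [M] is bounded below through its eigenvalues alone, hence
    the hypothesis on characteristic polynomials; [M] will be BZA. *)
Lemma uinorm_diag_mul_le n (N : 'M[C]_n -> C) (a b : C) (z : 'rV[C]_n) (P M : 'M[C]_n) :
  unitarily_invariant N -> 0 < a -> 0 < b -> (forall i, b <= z 0 i <= a) -> psdmx P ->
  char_poly M = char_poly (diag_mx z *m P) ->
  N (diag_mx z *m P) <= kconst a b * N M.
Proof.
move=> N_inv a0 b0 zab [Pherm Pev] MP.
have z0 i : 0 < z 0 i by apply: lt_le_trans b0 _; case/andP: (zab i).
have [Y [e [Yu PE]]] := hermitian_spectral Pherm.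
have e0 i : 0 <= e 0 i by apply: Pev; rewrite PE eigenvalue_spectral.
pose w : 'rV[C]_n := \row_i sqrtC (z 0 i).
have w0 i : 0 < w 0 i by rewrite mxE sqrtC_gt0.
pose W := diag_mx w; pose W' := diag_mx (\row_i (w 0 i)^-1).
have WW : W *m W = diag_mx z.
  by rewrite mulmx_diag; congr diag_mx; apply/rowP => i; rewrite !mxE -expr2 sqrtCK.
have WW' : W *m W' = 1%:M.
  rewrite mulmx_diag -diag_const_mx; congr diag_mx; apply/rowP => i.
  by rewrite [LHS]mxE [X in _ * X]mxE [RHS]mxE mulfV ?gt_eqF.
have Wh : W^t* = W.
  rewrite tr_diag_mx map_diag_mx; congr diag_mx; apply/rowP => i.
  by rewrite [LHS]mxE /= geC0_conj // ltW.
(* A square root of the spectrum of [P] exhibits S = W P W as a Gram matrix, which makes it positive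
   semidefinite. *)
pose E := diag_mx (\row_i sqrtC (e 0 i)); pose G := W *m Y^t* *m E.
have EE : E *m E^t* = diag_mx e.
  rewrite tr_diag_mx map_diag_mx mulmx_diag; congr diag_mx; apply/rowP => i.
  by rewrite !mxE /= geC0_conj ?sqrtC_ge0 // -expr2 sqrtCK.
have SG : W *m P *m W = G *m G^t*.
  rewrite /G 2!trmx_mul 2!map_mxM trmxCK Wh !mulmxA -[X in X *m Y]mulmxA EE PE.
  by rewrite !mulmxA.
have [Sherm Sev] := psdmx_gram G; rewrite -SG in Sherm Sev.
have [Q0 [lam0 [Q0u SE]]] := hermitian_spectral Sherm.
have lam0_ge0 i : 0 <= lam0 0 i by apply: Sev; rewrite SE eigenvalue_spectral.
have [p lam0_dec] := sort_row lam0_ge0.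
pose Q := perm_mx p *m Q0; pose lam := \row_i lam0 0 (p i).
have Qu : Q \is unitarymx by rewrite mul_unitarymx ?unitary_permmx.
have SQ : W *m P *m W = Q^t* *m diag_mx lam *m Q.
  have -> : diag_mx lam = perm_mx p *m diag_mx lam0 *m (perm_mx p)^t*.
    rewrite tr_perm_mx map_perm_mx -row_permE -col_permE; apply/matrixP => i j; rewrite !mxE.
    by rewrite (inj_eq perm_inj).
  have pp : (perm_mx p)^t* *m perm_mx p = 1%:M :> 'M[C]_n.
    by rewrite -invmx_unitary ?mulVmx ?unitarymx_unit ?unitary_permmx.
  rewrite SE /Q trmx_mul map_mxM !mulmxA.
  by do 2!rewrite -(mulmxA _ _ (perm_mx p)) pp mulmx1.
have XE : diag_mx z *m P = W *m (Q^t* *m diag_mx lam *m Q) *m W'.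
  by rewrite -SQ -WW !mulmxA -[RHS]mulmxA WW' mulmx1.
have W'W : W' *m W = 1%:M by exact: mulmx1C.
have [U [V [s [Uu Vu s0 s_dec XS]]]] := singular_value_decomposition (diag_mx z *m P).
have lam_ge0 i : 0 <= lam 0 i by rewrite mxE.
have sle i : s 0 i <= kconst a b * lam 0 i.
  apply: (similar_singular_value_le a0 b0 w0 _ lam_ge0 s0 _ s_dec Qu Uu Vu).
  - by move=> k; rewrite mxE sqrtCK.
  - by move=> k l kl; rewrite !mxE lam0_dec.
  - by rewrite -XS XE.
rewrite XS uinorm_mul //.
apply: (@le_trans _ _ (N (diag_mx (kconst a b *: lam)))).
  by apply: uinorm_diag_le => // i; rewrite mxE s0 sle.
have -> : diag_mx (kconst a b *: lam) = kconst a b *: diag_mx lam.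
  by apply/matrixP => i j; rewrite !mxE mulrnAr.
have K0 := kconst_ge0 a0 b0.
rewrite uinorm_scale // ler_wpM2l //; apply: uinorm_char_poly => //.
rewrite MP XE char_poly_conj // char_poly_conj; last exact: unitarymxP.
by rewrite char_poly_trig ?diag_mx_is_trig //; apply: eq_bigr => i _; rewrite mxE eqxx mulr1n.
Qed.

(** Conjugating by the unitary [Y] that diagonalises Z changes neither the norm nor the
    characteristic polynomial of ZAB, and the latter is shared by the cyclic rotation BZA. *)
Lemma uinorm_mul_le n (A B Z : 'M[C]_n) (a b : C) (N : 'M[C]_n -> C) :
  psdmx (A *m B) -> pdmx Z ->
  largest_eigenvalue Z a -> smallest_eigenvalue Z b ->
  unitarily_invariant N ->
  N (Z *m A *m B) <= kconst a b * N (B *m Z *m A).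
Proof.
move=> ABpsd [Zherm Zpos] [aev amax] [bev bmin] N_inv.
have [Y [z [Yu ZE]]] := hermitian_spectral Zherm.
have YtY : Y^t* *m Y = 1%:M by rewrite -invmx_unitary ?mulVmx ?unitarymx_unit.
have YYt : Y *m Y^t* = 1%:M by exact: unitarymxP.
have zev i : eigenvalue Z (z 0 i) by rewrite ZE eigenvalue_spectral.
pose P := Y *m (A *m B) *m Y^t*.
have XE : Z *m A *m B = Y^t* *m (diag_mx z *m P) *m Y.
  by rewrite /P ZE !mulmxA -[RHS]mulmxA YtY mulmx1.
rewrite XE uinorm_mul ?trmxC_unitary //.
apply: uinorm_diag_mul_le => //.
- exact: Zpos.
- exact: Zpos.
- by move=> i; rewrite amax ?bmin.
- have [ABherm ABev] := ABpsd; split.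
    have ABt : (A *m B)^t* = A *m B := ABherm.
    by rewrite /Defs.hermitianmx /adjmx /P 2!trmx_mul 2!map_mxM ABt trmxCK mulmxA.
  move=> l; rewrite eigenvalue_root_char char_poly_conj // -eigenvalue_root_char.
  exact: ABev.
- rewrite -mulmxA char_poly_mulC XE char_poly_conj //.
Qed.

End Inequality.

(** * Sharpness of the constant *)

Section Sharpness.
Context {C : numClosedFieldType}.
Local Notation "''[' u , v ]" := (dotmx u v) : ring_scope.
Local Notation "''[' u ]" := (dotmx u u) : ring_scope.

Lemma eigenvalue_diag_mx n (z : 'rV[C]_n) l :
  eigenvalue (diag_mx z) l -> exists i, l = z 0 i.
Proof.
move=> /eigenvalueP[v vl v0]; have /rV0Pn[i vi] := v0.
exists i; apply: (mulfI vi); have /rowP/(_ i) := vl.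
by rewrite mul_mx_diag !mxE => ->; apply: mulrC.
Qed.

Lemma diag_mx_eigenvalue n (z : 'rV[C]_n) i : eigenvalue (diag_mx z) (z 0 i).
Proof.
have -> : diag_mx z = 1%:M^t* *m diag_mx z *m 1%:M.
  by rewrite trmx1 map_mx1 mul1mx mulmx1.
by apply: eigenvalue_spectral; apply/unitarymxP; rewrite trmx1 map_mx1 mulmx1.
Qed.

(** Flattening by [mxvec] lets the triangle inequality come from the inner product on rows; unitary
    invariance is read off the trace form in [dotmx_mxvec]. *)
Definition frobenius n (X : 'M[C]_n) : C := sqrtC '[mxvec X].

Lemma dotmx_mxvec n (X : 'M[C]_n) : '[mxvec X] = \tr (X *m X^t*).
Proof.
transitivity (\sum_i \sum_j `|X i j| ^+ 2).
  rewrite dotmx_sqr (reindex _ (curry_mxvec_bij _ _)) /= pair_bigA.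
  by apply: eq_bigr => -[i j] _ /=; rewrite mxvecE.
apply: eq_bigr => i _; rewrite mxE; apply: eq_bigr => j _.
by rewrite !mxE normCK.
Qed.

Lemma frobenius_unitarily_invariant n : unitarily_invariant (@frobenius n).
Proof.
split; first split.
- by move=> X; rewrite sqrtC_ge0 dotmx_ge0.
- move=> X /eqP; rewrite sqrtC_eq0 => X0; apply: contraTeq X0 => X0.
  by rewrite gt_eqF // dotmx_gt0 // mxvec_eq0.
- move=> c X; rewrite /frobenius !dotmx_sqr.
  have -> : \sum_i `|mxvec (c *: X) 0 i| ^+ 2 = `|c| ^+ 2 * \sum_i `|mxvec X 0 i| ^+ 2.
    by rewrite mulr_sumr; apply: eq_bigr => i _; rewrite linearZ /= mxE normrM exprMn.
  rewrite sqrtCM ?nnegrE ?exprn_ge0 ?sumr_ge0 ?sqrtC_norm // => [|i _].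
    by rewrite sqrCK.
  by rewrite exprn_ge0.
- by move=> X Y; rewrite /frobenius linearD /=; apply: triangle_lerif.
move=> U V X /unitarymxP Uu /unitarymxP Vu; rewrite /frobenius !dotmx_mxvec.
rewrite !trmx_mul !map_mxM !mulmxA mulmxtVK // mxtrace_mulC !mulmxA.
by rewrite -(invmx_unitary Uu) mulVmx ?mul1mx // unitarymx_unit.
Qed.

Lemma kantorovich_extremal (a b c : C) : 0 < b -> b <= a -> c < kconst a b ->
  exists (n : nat) (A B Z : 'M[C]_n) (N : 'M[C]_n -> C),
     (0 < n)%N /\ psdmx (A *m B) /\ pdmx Z /\
     largest_eigenvalue Z a /\ smallest_eigenvalue Z b /\
     unitarily_invariant N /\
     c * N (B *m Z *m A) < N (Z *m A *m B).
Proof.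
move=> b0 ba cK; have a0 := lt_le_trans b0 ba.
have ab0 : 0 < a + b by apply: addr_gt0.
have g0 : 0 < sqrtC (a * b) by rewrite sqrtC_gt0 mulr_gt0.
pose z : 'rV[C]_2 := \row_i (if i == 0 then a else b).
(* Both entries of h Z^(1/2) have square ab: equal weights at a and b are the equality case of
   [kantorovich]. *)
pose h : 'rV[C]_2 := \row_i (if i == 0 then sqrtC b else sqrtC a).
pose A := h^T *m h; pose Z := diag_mx z.
have zP i : z 0 i = a \/ z 0 i = b by rewrite mxE; case: ifP; [left|right].
have hh : h *m h^T = (a + b)%:M.
  apply/matrixP => i j; rewrite !ord1 !mxE big_ord_recl big_ord1 !mxE /=.
  by rewrite -!expr2 !sqrtCK addrC.
have hZh : h *m Z *m h^T = (2%:R * (a * b))%:M.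
  apply/matrixP => i j; rewrite mul_mx_diag !ord1 !mxE big_ord_recl big_ord1 !mxE /=.
  rewrite mulrAC -expr2 sqrtCK mulrAC -expr2 sqrtCK; ring.
have hZZh : h *m Z *m Z *m h^T = (a * b * (a + b))%:M.
  apply/matrixP => i j; rewrite !mul_mx_diag !ord1 !mxE big_ord_recl big_ord1 !mxE /=.
  rewrite mulr1n; transitivity (a * a * sqrtC b ^+ 2 + b * b * sqrtC a ^+ 2); first by ring.
  by rewrite !sqrtCK; ring.
have AA : A *m A = (a + b) *: A.
  by rewrite /A mulmxA -(mulmxA _ h) hh mul_mx_scalar scalemxAl.
have AZA : A *m Z *m A = (2%:R * (a * b)) *: A.
  by rewrite /A !mulmxA -2!(mulmxA h^T) hZh mul_mx_scalar scalemxAl.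
have At : A^t* = A.
  have hc : map_mx Num.conj h = h.
    by apply/rowP => i; rewrite !mxE; case: ifP => _; rewrite geC0_conj // sqrtC_ge0 ltW.
  by rewrite /A trmx_mul trmxK map_mxM -map_trmx hc.
have trA : \tr A = a + b by rewrite mxtrace_mulC hh mxtrace_scalar.
have NA : frobenius A = a + b.
  by rewrite /frobenius dotmx_mxvec At AA mxtraceZ trA -expr2 sqrCK // ltW.
have Zt : Z^t* = Z.
  rewrite tr_diag_mx map_diag_mx; congr diag_mx; apply/rowP => i.
  rewrite [LHS]mxE /= geC0_conj //; case: (zP i) => ->; exact: ltW.
have NZA : frobenius (Z *m A) = sqrtC (a * b) * (a + b).
  rewrite /frobenius dotmx_mxvec trmx_mul map_mxM At Zt mulmxA -(mulmxA Z) AA.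
  rewrite -scalemxAr -scalemxAl mxtraceZ mxtrace_mulC mulmxA /A mulmxA mxtrace_mulC.
  rewrite !mulmxA hZZh mxtrace_scalar.
  have -> : (a + b) * (a * b * (a + b) *+ 1) = a * b * (a + b) ^+ 2 by rewrite mulr1n; ring.
  by rewrite sqrtCM ?nnegrE ?sqrCK ?exprn_ge0 ?mulr_ge0 ?ltW.
have [[_ _ Nscale _] _] := frobenius_unitarily_invariant 2.
have zev l : eigenvalue Z l -> l = a \/ l = b.
  by move=> /eigenvalue_diag_mx[i ->]; apply: zP.
have [aev bev] : eigenvalue Z a /\ eigenvalue Z b.
  by have := (diag_mx_eigenvalue z 0, diag_mx_eigenvalue z 1); rewrite !mxE => -[].
exists 2%N, A, A, Z, (@frobenius 2); split=> //; split.
  by rewrite -[X in _ *m X]At; apply: psdmx_gram.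
split; first by split=> // l /zev[]->.
split; first by split=> // l /zev[]->.
split; first by split=> // l /zev[]->.
split; first exact: frobenius_unitarily_invariant.
rewrite -[Z *m A *m A]mulmxA AA -scalemxAr AZA !Nscale NA NZA.
rewrite !ger0_norm ?mulr_ge0 ?ler0n ?(ltW a0) ?(ltW b0) ?(ltW ab0) //.
(* The norms are 2ab(a+b) for AZA and (a+b)^2 sqrt(ab) for ZAA. Their ratio is exactly [kconst a b],
   and since the first is positive, a smaller [c] fails strictly. *)
apply: (@lt_le_trans _ _ (kconst a b * (2%:R * (a * b) * (a + b)))).
  by rewrite ltr_pM2r // !mulr_gt0 // ltr0n.
rewrite le_eqVlt; apply/orP; left; apply/eqP.
(* Writing ab as the square of its root g leaves an identity of rational functions in a, b and g. *)
have gg : a * b = sqrtC (a * b) ^+ 2 by rewrite sqrtCK.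
rewrite /kconst {2}gg; set g := sqrtC _ in g0 *; field.
by rewrite gt_eqF.
Qed.

End Sharpness.

Theorem theorem1p2 (R : realType) :
  (forall (n : nat) (A B Z : 'M[R[i]]_n) (a b : R[i]) (N : 'M[R[i]]_n -> R[i]),
      (0 < n)%N ->
      psdmx (A *m B) -> pdmx Z ->
      largest_eigenvalue Z a -> smallest_eigenvalue Z b ->
      unitarily_invariant N ->
      N (Z *m A *m B) <= kconst a b * N (B *m Z *m A))
  /\
  (forall (a b : R[i]), 0 < b -> b <= a ->
   forall c : R[i], c < kconst a b ->
   exists (n : nat) (A B Z : 'M[R[i]]_n) (N : 'M[R[i]]_n -> R[i]),
     (0 < n)%N /\ psdmx (A *m B) /\ pdmx Z /\
     largest_eigenvalue Z a /\ smallest_eigenvalue Z b /\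
     unitarily_invariant N /\
     c * N (B *m Z *m A) < N (Z *m A *m B)).
Proof.
split=> [n A B Z a b N _ | a b b0 ba c cK]; first exact: uinorm_mul_le.
exact: kantorovich_extremal.
Qed.
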